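(* Let $p\ge 3$ and $q\ge 1$ be integers. For all sufficiently large $n$, we have $Y_p(n)\in \mathcal{G}(n,p,1)\subseteq \mathcal{G}(n,p,q)$.
   Context: For integers $p\ge 2$, $q\ge 1$, the complete split graph (generalized book graph) is $B_{p,q}=K_p\nabla qK_1$, the join of a clique $K_p$ with an independent set of $q$ vertices (every vertex of the $K_p$ adjacent to every one of the $q$ vertices). A graph is non-$p$-partite if its chromatic number exceeds $p$. $\mathcal{G}(n,p,q)$ denotes the set of graphs with the largest number of edges among all $n$-vertex non-$p$-partite $B_{p,q}$-free graphs (graphs containing no subgraph isomorphic to $B_{p,q}$). $T_{m,p}$ denotes the Turán graph, the complete $p$-partite graph on $m$ vertices with part sizes as equal as possible. The graph $Y_p(n)$ is defined as follows: let $T_1,\dots,T_p$ be the color classes of $T_{n-1,p}$ with $\lfloor\frac{n-1}{p}\rfloor=|T_1|\le |T_2|\le\cdots\le |T_p|=\lceil\frac{n-1}{p}\rceil$, pick $u_1\in T_1$, $u_2\in T_2$; $Y_p(n)$ is obtained from $T_{n-1,p}$ by deleting the edge $u_1u_2$ and adding a new vertex $u_0$ adjacent to all vertices of $(T_3\cup\cdots\cup T_p)\cup\{u_1,u_2\}$. *)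

(* Defs.v *)
From mathcomp Require Import all_boot all_order.
Set Implicit Arguments. Unset Strict Implicit. Unset Printing Implicit Defensive.

Definition simple_graph (n : nat) (G : rel 'I_n) : bool :=
  [forall x, ~~ G x x] && [forall x, forall y, G x y == G y x].

Definition num_edges (n : nat) (G : rel 'I_n) : nat :=
  #|[set e : 'I_n * 'I_n | (e.1 < e.2) && G e.1 e.2]|.

Definition p_partite (n p : nat) (G : rel 'I_n) : Prop :=
  exists f : 'I_n -> 'I_p, forall x y, G x y -> f x != f y.

Definition non_p_partite (n p : nat) (G : rel 'I_n) : Prop := ~ @p_partite n p G.

Definition contains_subgraph (V W : finType) (H : rel V) (G : rel W) : Prop :=
  exists f : V -> W, injective f /\ forall a b, H a b -> G (f a) (f b).

Definition book (p q : nat) : rel ('I_p + 'I_q) :=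
  fun a b => match a, b with
             | inl i, inl j => i != j
             | inl _, inr _ => true
             | inr _, inl _ => true
             | inr _, inr _ => false
             end.

Definition book_free (n p q : nat) (G : rel 'I_n) : Prop :=
  ~ @contains_subgraph _ _ (@book p q) G.

Definition in_calG (n p q : nat) (G : rel 'I_n) : Prop :=
  [/\ simple_graph G, @non_p_partite n p G, @book_free n p q G &
      forall H : rel 'I_n, simple_graph H -> @non_p_partite n p H ->
        @book_free n p q H -> num_edges H <= num_edges G].

(* The graph Y_p(n) on 'I_n.  Vertex 0 is u_0; vertices v = 1..n-1 form
   T_{n-1,p}, vertex v lying in class (v-1) %% p.  Class p-1 is a smallest
   class (T_1) and class p-2 is a smallest class among the rest (T_2).
   u_1 = p (class p-1), u_2 = p-1 (class p-2). *)
Definition Ycls (p : nat) (v : nat) : nat := (v.-1) %% p.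

Definition Y_adj (p : nat) (x y : nat) : bool :=
  let u1 := p in let u2 := p.-1 in
  (x != y) &&
  if (x == 0) then
    (Ycls p y != p.-1) && (Ycls p y != p.-2) || (y == u1) || (y == u2)
  else if (y == 0) then
    (Ycls p x != p.-1) && (Ycls p x != p.-2) || (x == u1) || (x == u2)
  else
    (Ycls p x != Ycls p y) && ~~ [|| (x == u1) && (y == u2) | (x == u2) && (y == u1)].

Definition Yp (p n : nat) : rel 'I_n := fun x y => Y_adj p x y.

(* Main.v *)
Require Import Defs.
From mathcomp Require Import all_boot all_order.
From mathcomp Require Import zify ring.
Set Implicit Arguments. Unset Strict Implicit. Unset Printing Implicit Defensive.

(** A non-p-partite graph G without B_{p,q} has at most e(Y_p(n)) edges, by progressive
    induction on n.  If every vertex misses at most n/p + t vertices (t a small multiple of n),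
    then G is p-partite: the classes are read off from a fixed K_p, and any edge inside a class
    extends greedily to a K_p whose common neighbourhood is large.  Otherwise delete a vertex d
    of small degree.  If G - d is not p-partite, the excess over e(Y_p) strictly decreases.  If
    G - d is p-partite, put d into the class i in which it has fewest neighbours.  An edge dx
    inside class i forces d and x to miss together almost all of some other class j; since p >= 3,
    an edge between N(d) in class i and N(d) in class j would force about n/p further missing
    pairs, which is too many.  With k <= l neighbours of d in classes i and j, at least
    |V_j| - l + k l cross pairs are missing while only k internal edges are gained, and
    (k - 1)(l - 1) >= 0 gives the bound. *)

(** * Greedy construction of books *)

Definition clique (V : finType) (G : rel V) (Q : {set V}) : Prop :=
  {in Q &, forall x y, x != y -> G x y}.

Definition colorable (V : finType) (p : nat) (G : rel V) : Prop :=
  exists f : V -> 'I_p, forall x y, G x y -> f x != f y.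

Definition common (V : finType) (G : rel V) (Q : {set V}) : {set V} :=
  [set y | [forall x in Q, G x y]].

Section Greedy.
Variables (V : finType) (G : rel V) (p q : nat).
Hypotheses (Gsym : symmetric G) (Girr : irreflexive G).

Lemma cliqueU1 (Q : {set V}) y : clique G Q -> y \in common G Q -> clique G (y |: Q).
Proof.
move=> cQ; rewrite inE => /forall_inP yQ a b /setU1P [->|aQ] /setU1P [->|bQ].
- by rewrite eqxx.
- by rewrite Gsym yQ.
- by rewrite yQ.
- exact: cQ.
Qed.

Lemma common_notin (Q : {set V}) y : y \in common G Q -> y \notin Q.
Proof.
by rewrite inE => /forall_inP yQ; apply/negP => /yQ; rewrite Girr.
Qed.

Lemma book_of_clique (Q : {set V}) :
  clique G Q -> #|Q| = p -> q <= #|common G Q| -> contains_subgraph (@book p q) G.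
Proof.
move=> cQ cardQ qC.
pose f (a : 'I_p + 'I_q) : V := match a with
  | inl i => enum_val (cast_ord (esym cardQ) i)
  | inr j => enum_val (widen_ord qC j) end.
have adj i j : G (f (inl i)) (f (inr j)).
  have : enum_val (widen_ord qC j) \in common G Q := enum_valP (widen_ord qC j).
  by rewrite inE => /forall_inP; apply; exact: enum_valP.
exists f; split.
- move=> [i|i] [j|j].
  + by move/enum_val_inj/cast_ord_inj->.
  + by move=> e; have := adj i j; rewrite e Girr.
  + by move=> e; have := adj j i; rewrite e Girr.
  + by move/enum_val_inj=> e; congr inr; apply: val_inj; have /= := congr1 val e.
- move=> [i|i] [j|j] //= ij.
  + apply: cQ; rewrite ?enum_valP //.
    by apply: contraNneq ij => /enum_val_inj/cast_ord_inj->.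
  + exact: adj.
  + by rewrite Gsym; exact: adj.
Qed.

(** [J] is the set of classes still to be visited. Adding to [Q] a common neighbour from one of them
    costs every other class at most [t] common neighbours. The last class supplies the [q] pages,
    hence the total [p.+1]. *)
Lemma greedy_book (A : {set V}) (f : V -> 'I_p) (t : nat) (J : {set 'I_p}) (Q : {set V}) :
  0 < q ->
  {in A, forall x, #|[set y in A | (f y != f x) && ~~ G x y]| <= t} ->
  clique G Q -> #|Q| + #|J| = p.+1 -> J != set0 ->
  {in J, forall j, #|J| * t + q <= #|[set y in A | (f y == j) && (y \in common G Q)]|} ->
  contains_subgraph (@book p q) G.
Proof.
move=> q0 At; elim: {J}_.+1 {-2}J (ltnSn #|J|) Q => // m IH J; rewrite ltnS => Jm Q cQ QJ J0 HJ.
have [j jJ] := set0Pn _ J0.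
have [y] : exists y, y \in [set y in A | (f y == j) && (y \in common G Q)].
  by apply/set0Pn; rewrite -card_gt0; have := HJ j jJ; lia.
rewrite inE => /and3P [yA /eqP fy yQ].
have [J1|J1] := eqVneq (J :\ j) set0.
  have cJ : #|J| = 1 by have := cardsD1 j J; rewrite jJ J1 cards0; lia.
  apply: (@book_of_clique Q) => //; first by lia.
  apply: leq_trans (subset_leq_card (_ : [set y in A | (f y == j) && (y \in common G Q)] \subset _)); first by have := HJ j jJ; lia.
  by apply/subsetP => z; rewrite inE => /and3P[].
have cJ := cardsD1 j J; rewrite jJ in cJ.
apply: (IH (J :\ j) _ (y |: Q)) => //; first by lia.
- exact: cliqueU1.
- by rewrite cardsU1 (common_notin yQ); lia.
move=> i; rewrite !inE => /andP [ij iJ].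
have H1 := HJ i iJ; have H2 := At y yA.
have : #|[set z in A | (f z == i) && (z \in common G Q)]| <=
  #|[set z in A | (f z == i) && (z \in common G (y |: Q))]| + #|[set z in A | (f z != f y) && ~~ G y z]|.
  apply: leq_trans (leq_card_setU _ _); apply: subset_leq_card.
  apply/subsetP => z; rewrite !inE => /and3P [-> /eqP fz zQ] /=.
  rewrite fz fy eqxx ij /= orbC; case Gyz : (G y z) => //=.
  apply/forall_inP => x /setU1P [->//|]; exact: (forall_inP zQ).
move: H1; rewrite cJ; lia.
Qed.

Lemma greedy_gap (A : {set V}) (f : V -> 'I_p) (t : nat) (J : {set 'I_p}) (Q : {set V}) :
  ~ contains_subgraph (@book p q) G -> 0 < q ->
  {in A, forall x, #|[set y in A | (f y != f x) && ~~ G x y]| <= t} ->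
  clique G Q -> #|Q| + #|J| = p.+1 -> J != set0 ->
  exists2 j, j \in J & #|[set y in A | (f y == j) && (y \in common G Q)]| < p * t + q.
Proof.
move=> nb q0 At cQ QJ J0.
case: (boolP [exists j in J, #|[set y in A | (f y == j) && (y \in common G Q)]| < p * t + q]).
  by case/exists_inP => j; exists j.
move/exists_inPn => H; case: nb; apply: (greedy_book q0 At cQ QJ J0) => j /H.
rewrite -leqNgt; apply: leq_trans; rewrite leq_add2r leq_mul2r.
by have := max_card (mem J); rewrite card_ord => ->; rewrite orbT.
Qed.

End Greedy.

(** * Graphs of large minimum degree *)

Lemma card_sum_indicator (V : finType) (P : pred V) : #|[set x | P x]| = \sum_x (P x : nat).
Proof. by rewrite -sum1dep_card big_mkcond; apply: eq_bigr => x _; case: (P x). Qed.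

Lemma card_setI_common (V : finType) (G : rel V) (C Q : {set V}) :
  #|C| <= #|C :&: common G Q| + \sum_(x in Q) #|[set y in C | ~~ G x y]|.
Proof.
have <- : \sum_(y in C) 1 = #|C| by rewrite sum1_card.
have -> : #|C :&: common G Q| = \sum_(y in C) (y \in common G Q : nat).
  rewrite -sum1_card big_mkcond [RHS]big_mkcond; apply: eq_bigr => y _.
  by rewrite in_setI; do 2!case: (_ \in _).
under [X in _ <= _ + X]eq_bigr => x _ do rewrite -sum1dep_card big_mkcondr /=.
rewrite exchange_big -big_split /=; apply: leq_sum => y yC.
case: (boolP (y \in common G Q)) => //; rewrite inE => /forall_inPn [x xQ Gxy].
by rewrite (bigD1 x) //= Gxy.
Qed.

Section MinDegree.
Variables (V : finType) (G : rel V) (p q t : nat).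
Hypotheses (Gsym : symmetric G) (Girr : irreflexive G).
Hypotheses (nb : ~ contains_subgraph (@book p q) G) (p3 : 3 <= p) (q0 : 0 < q) (qt : q <= t).
Hypotheses (nK : 20 * p ^ 3 * t <= #|V|).
Hypotheses (mindeg : forall x, p * #|[set y | ~~ G x y]| <= #|V| + p * t).

(** Fewer than [p] vertices together miss at most [(p - 1) * (n / p + t) < n] vertices, so a smaller
    clique always extends. *)
Lemma exists_clique s : s <= p -> exists2 Q : {set V}, clique G Q & #|Q| = s.
Proof.
elim: s => [_|s IH sp].
  by exists set0; rewrite ?cards0 // => x y; rewrite inE.
have [Q cQ Qs] := IH (ltnW sp).
have [E|[y yQ]] := set_0Vmem (common G Q); last first.
  exists (y |: Q); first exact: cliqueU1.
  by rewrite cardsU1 (common_notin Girr yQ) Qs.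
have := card_setI_common G setT Q; rewrite E setI0 cards0 add0n cardsT => H.
have : p * \sum_(x in Q) #|[set y in setT | ~~ G x y]| <= s * (#|V| + p * t).
  rewrite big_distrr -Qs -sum_nat_const /=; apply: leq_sum => x _.
  by apply: leq_trans (mindeg x); rewrite leq_mul2l; apply/orP; right; apply/subset_leq_card/subsetP => z; rewrite !inE.
move: nK; rewrite (_ : p ^ 3 = p * p * p) ?expnS ?muln1 ?mulnA //.
move: (\sum_(_ in _) _) H => S; move: #|V| => n.
move=> H1 nK' H2.
have E1 : s * (n + p * t) <= (p - 1) * (n + p * t) by rewrite leq_mul2r; apply/orP; right; lia.
have E2 : p * n <= p * S by rewrite leq_mul2l H1 orbT.
have E3 : p * p * t <= p * p * p * t by move: p3; nia.
have E4 : t <= p * p * p * t by move: p3; nia.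
have E5 : (p - 1) * (n + p * t) + (n + p * t) = p * (n + p * t) by rewrite -mulSnr; congr (_ * _); lia.
lia.
Qed.

Lemma colorable_of_min_degree : colorable p G.
Proof.
have [Q cQ Qp] := exists_clique (leqnn p).
pose v (i : 'I_p) : V := enum_val (cast_ord (esym Qp) i).
have vQ i : v i \in Q by apply: enum_valP.
have vinj : injective v by move=> i j /enum_val_inj/cast_ord_inj.
have Qv : Q = [set v i | i in 'I_p].
  apply/eqP; rewrite eq_sym eqEcard card_imset // card_ord Qp leqnn andbT.
  by apply/subsetP => _ /imsetP [i _ ->].
pose miss w := [set i | ~~ G (v i) w].
(* The vertices missing exactly one [v i], whose index becomes their class; [v i] is among them,
   since it misses only itself. *)
pose A := [set w | #|miss w| == 1].
have i0 : 'I_p by exists 0; lia.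
pose f w := odflt i0 [pick i in miss w].
have fP w j : w \in A -> G (v j) w = (j != f w).
  rewrite inE => /cards1P [i Ei].
  have -> : f w = i.
    rewrite /f; case: pickP => [k|/(_ i)]; rewrite Ei inE ?eqxx //.
    by move/eqP.
  have := in_set1 j i; rewrite -Ei inE => <-.
  by rewrite negbK.
pose C i := [set w in A | f w == i].
pose nd x := #|[set y | ~~ G x y]|.
have Cnd i : #|C i| <= nd (v i).
  apply/subset_leq_card/subsetP => w; rewrite !in_set -/A => /andP [wA /eqP <-].
  by rewrite fP ?eqxx ?in_set.
have sumC : #|A| = \sum_i #|C i|.
  rewrite -sum1_card (partition_big f xpredT) //=; apply: eq_bigr => i _.
  by rewrite -sum1dep_card.
have comQ : #|common G Q| < q.
  rewrite ltnNge; apply/negP => H; apply: nb; exact: (book_of_clique Gsym Girr cQ Qp).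
have missD : \sum_w #|miss w| = \sum_i nd (v i).
  under eq_bigr => w _ do rewrite card_sum_indicator.
  by rewrite exchange_big; apply: eq_bigr => i _; rewrite -card_sum_indicator.
have sumnd : \sum_i nd (v i) <= #|V| + p * t.
  have : p * \sum_i nd (v i) <= p * (#|V| + p * t).
    rewrite big_distrr /=.
    apply: leq_trans (_ : \sum_(i < p) (#|V| + p * t) <= _); first by apply: leq_sum => i _; exact: mindeg.
    by rewrite sum_nat_const card_ord.
  by rewrite leq_pmul2l //; lia.
have cardA : #|V| <= #|A| + p * t + 2 * q.
  (* A vertex misses at least two vertices of [Q] unless it is in [A] (one) or in [common G Q]
     (none). *)
  have : 2 * #|V| <= \sum_w #|miss w| + #|A| + 2 * #|common G Q|.
    rewrite -[#|A|]sum1_card -[#|common _ _|]sum1_card (big_mkcond (mem A)) (big_mkcond (mem (common G Q))) /=.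
    rewrite big_distrr /= -!big_split /= mulnC -sum_nat_const.
    apply: leq_sum => w _.
    case: (boolP (w \in A)) => [|wA]; first by rewrite inE => /eqP ->.
    case: (boolP (w \in common G Q)) => [_|]; first by rewrite addn0 muln1 leq_addl.
    rewrite inE => /forall_inPn [x]; rewrite Qv => /imsetP [i _ ->] H.
    move: wA; rewrite inE => N1; have : 0 < #|miss w| by apply/card_gt0P; exists i; rewrite inE.
    by case: #|miss w| N1 => [|[|k]].
  rewrite missD; lia.
(* Each of the other classes has size at most [n / p + t] by [Cnd], and [A] is nearly everything. *)
have cardC i : #|V| <= p * #|C i| + 3 * p * p * t.
  have H : p * \sum_(j | j != i) #|C j| <= (p - 1) * (#|V| + p * t).
    rewrite big_distrr /=.
    apply: leq_trans (_ : \sum_(j | j != i) (#|V| + p * t) <= _).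
      by apply: leq_sum => j _; apply: leq_trans (mindeg (v j)); rewrite leq_mul2l; apply/orP; right; apply: Cnd.
    rewrite sum_nat_const leq_mul2r; apply/orP; right.
    by rewrite (eq_card (B := predC1 i)) ?cardC1 ?card_ord //; lia.
  move: cardA; rewrite sumC (bigD1 i) //=.
  move: H; move: (\sum_(_ | _) _) #|C i| #|V| => s c n HS HC.
  have E1 : (p - 1) * (n + p * t) + (n + p * t) = p * (n + p * t) by rewrite -mulSnr; congr (_ * _); lia.
  have E2 : p * n <= p * (c + s + p * t + 2 * q) by rewrite leq_mul2l HC orbT.
  have E3 : p * q <= p * t by rewrite leq_mul2l qt orbT.
  have E4 : p * t <= p * (p * t) by rewrite leq_pmull //; lia.
  lia.
(* Given [q] neighbours of [w] in its own class, replacing [v i] by [w] in [Q] would give the spine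
   of a book. *)
have fewC i w : w \in C i -> #|[set y in C i | G w y]| < q.
  rewrite inE => /andP [wA /eqP fw].
  rewrite ltnNge; apply/negP => H; apply: nb.
  have vi : v i \in Q by [].
  have wcom : w \in common G (Q :\ v i).
    rewrite inE; apply/forall_inP => x /setD1P [xi]; rewrite Qv => /imsetP [j _ xj].
    by rewrite xj fP // fw; apply: contraNneq xi => <-; rewrite xj.
  apply: (@book_of_clique _ G p q Gsym Girr (w |: Q :\ v i)).
  - apply: cliqueU1 => //; move=> x y /setD1P [_ xQ] /setD1P [_ yQ]; exact: cQ.
  - by rewrite cardsU1 (common_notin Girr wcom); have := cardsD1 (v i) Q; rewrite vi; lia.
  apply: leq_trans H _; apply/subset_leq_card/subsetP => y.
  rewrite in_set [y \in C i]in_set => /andP [/andP [yA /eqP fy] wy].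
  rewrite in_set; apply/forall_inP => x /setU1P [->//|/setD1P [xi]]; rewrite Qv => /imsetP [j _ xj].
  by rewrite xj fP // fy; apply: contraNneq xi => <-; rewrite xj.
(* A vertex of [A] misses almost all of its own class, which nearly uses up its allowance of
   [n / p + t]. *)
have At : {in A, forall x, #|[set y in A | (f y != f x) && ~~ G x y]| <= 4 * p * t}.
  move=> x xA.
  have xC : x \in C (f x) by rewrite inE xA eqxx.
  have H1 := fewC _ _ xC; have H2 := cardC (f x); have H3 := mindeg x.
  have H4 : #|[set y in A | (f y != f x) && ~~ G x y]| + #|C (f x)| <= nd x + #|[set y in C (f x) | G x y]|.
    rewrite -[X in X + _ <= _]sum1dep_card -[X in _ + X <= _]sum1dep_card -[X in _ <= X + _]sum1dep_card -[X in _ <= _ + X]sum1dep_card.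
    rewrite ![X in X + _ <= _]big_mkcond ![X in _ + X <= _]big_mkcond ![X in _ <= X + _]big_mkcond ![X in _ <= _ + X]big_mkcond /=.
    rewrite -!big_split /=; apply: leq_sum => y _; rewrite !in_set -/A.
    by case: (_ == 1) => //; case: (f y == f x); case: (G x y).
  move: H1 H2 H3 H4; rewrite -/(nd x); move: #|[set y in C _ | _]| #|C _| (nd x) #|V| => a c b n.
  move: #|_| => m; move: qt p3 => qt' p3' H1 H2 H3 H4.
  have : p * m <= p * (4 * p * t) by nia.
  by rewrite leq_pmul2l; lia.
(* The classes are extended to all vertices: by [greedy_gap] from the single vertex [w], some class
   contains few neighbours of [w]. *)
pose few w i := #|[set y in C i | G w y]| < p * (4 * p * t) + q.
have fewP w : exists i, few w i.
  have [|||j _] := @greedy_gap V G p q Gsym Girr A f (4 * p * t) setT [set w] nb q0 At.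
  - by move=> x y /set1P -> /set1P ->; rewrite eqxx.
  - by rewrite cards1 cardsT card_ord.
  - by apply/set0Pn; exists i0.
  move=> H; exists j; apply: leq_ltn_trans H; apply/subset_leq_card/subsetP => y.
  rewrite !in_set -/A => /andP [/andP [-> ->] wy] /=.
  by apply/forall_inP => x /set1P ->.
pose F w := odflt i0 [pick i | few w i].
have FP w : few w (F w).
  rewrite /F; case: pickP => //= H; have [i] := fewP w; by rewrite H.
have Fmiss w j : j != F w -> #|[set y in C j | ~~ G w y]| <= 6 * p * p * t.
  move=> jF; have H1 := FP w; have H2 := cardC (F w); have H3 := mindeg w.
  have H4 : #|[set y in C j | ~~ G w y]| + #|C (F w)| <= nd w + #|[set y in C (F w) | G w y]|.
    rewrite -[X in X + _ <= _]sum1dep_card -[X in _ + X <= _]sum1dep_card -[X in _ <= X + _]sum1dep_card -[X in _ <= _ + X]sum1dep_card.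
    rewrite ![X in X + _ <= _]big_mkcond ![X in _ + X <= _]big_mkcond ![X in _ <= X + _]big_mkcond ![X in _ <= _ + X]big_mkcond /=.
    rewrite -!big_split /=; apply: leq_sum => y _; rewrite !in_set -/A.
    case: (_ == 1) => //; case: (eqVneq (f y) j) => [->|_]; first by rewrite (negbTE jF); case: (G w y).
    by case: (_ == _); case: (G w y).
  move: H1 H2 H3 H4; rewrite -/(nd w) /few; move: #|[set y in C (F w) | G w y]| #|C _| (nd w) #|V| => a c b n.
  move: #|_| => m; move: qt p3 => qt' p3' H1 H2 H3 H4.
  have : p * m <= p * (6 * p * p * t).
    have : p * m + n <= n + p * t + p * a + 3 * p * p * t by nia.
    have : p * a <= p * (p * (4 * p * t) + q) by rewrite leq_mul2l (ltnW H1) orbT.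
    have : p * q <= p * t by rewrite leq_mul2l qt' orbT.
    have : 2 * (p * t) + 3 * p * p * t <= 2 * (p * (p * (p * t))) by nia.
    lia.
  by rewrite leq_pmul2l; lia.
exists F => w w' ww'; apply/negP => /eqP FF.
(* For an edge [w w'] with [F w = F w'], some other class has few common neighbours of both ends,
   yet by [Fmiss] each end misses only a few vertices there. *)
have [|||j] := @greedy_gap V G p q Gsym Girr A f (4 * p * t) (~: [set F w]) [set w; w'] nb q0 At.
- move=> x y /set2P [->|->] /set2P [->|->]; rewrite ?eqxx // => _; by rewrite // Gsym.
- rewrite cards2 cardsC1 card_ord; case: eqVneq ww' => [->|_ _]; first by rewrite Girr.
  lia.
- by rewrite -card_gt0 cardsC1 card_ord; lia.
rewrite in_setC in_set1 => jF.
have H0 := cardC j; have H1 := Fmiss w j jF.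
have H2 : #|[set y in C j | ~~ G w' y]| <= 6 * p * p * t by apply: Fmiss; rewrite -FF.
have H3 := card_setI_common G (C j) [set w; w'].
have ww : w != w' by apply: contraTneq ww' => ->; rewrite Girr.
move: H3; rewrite (bigD1 w) ?set21 //= (bigD1 w') /= ?set22 1?eq_sym // big1 ?addn0; last first.
  by move=> x /andP [/andP [/set2P [->|->]]]; rewrite eqxx.
have -> : C j :&: common G [set w; w'] = [set y in A | (f y == j) && (y \in common G [set w; w'])].
  by apply/setP => y; rewrite in_setI [y \in C j]in_set [RHS]in_set andbA.
move: #|_| #|_| H1 H2 => a b H1 H2; move: #|_| #|C j| H0 => c d; move: nK p3 qt; rewrite (_ : p ^ 3 = p * p * p) ?expnS ?muln1 ?mulnA //.
move=> nK' p3' qt' H0 H3 H4.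
have E1 : p * d <= p * (12 * p * p * t + p * (4 * p * t) + t) by rewrite leq_mul2l; apply/orP; right; lia.
have E2 : p * t <= p * p * p * t by nia.
have E3 : 3 * (p * p * t) <= p * p * p * t by nia.
have E4 : 27 * t <= p * p * p * t by nia.
lia.
Qed.

End MinDegree.

(** * The extremal number *)

(* For [n >= p] this is the number of edges of Y_p(n): vertex [y] is joined to [y - (y + 1) %/ p]
   of the preceding vertices, and vertex [p - 1] to one more. *)
Definition eY (p n : nat) : nat := (\sum_(y < n) (y - y.+1 %/ p)).+1.

Lemma eYS p n : eY p n.+1 = eY p n + (n - n.+1 %/ p).
Proof. by rewrite /eY big_ord_recr. Qed.

(** With [b = n %/ p], the balanced partition has sum of squares [(2b + 1) n - p b (b + 1)], so this
    reads [eY p n = e(T_{n,p}) - b + 1], freed of subtraction. *)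
Lemma eY_closed p n : 2 <= p ->
  2 * eY p n + (2 * (n %/ p) + 1) * n + 2 * (n %/ p) =
  n * n + p * (n %/ p) * (n %/ p + 1) + 2.
Proof.
move=> p2; have p0 : 0 < p by lia.
elim: n => [|n IH]; first by rewrite /eY big_ord0 div0n !muln0.
rewrite eYS; have := divnS n p0.
have D := divn_eq n.+1 p; have D' : n.+1 %/ p <= n by have : n.+1 %/ p < n.+1 by apply: ltn_Pdiv.
case: (boolP (p %| n.+1)) => pn /=; last by rewrite add0n => E; rewrite E in D' *; lia.
rewrite add1n => E; rewrite E in D' *; move: D; rewrite (eqP pn) E addn0 => D.
have D2 : n = (n %/ p) * p + p - 1 by lia.
move: IH; move: (eY p n) (n %/ p) D D' D2 => e b D D' D2 IH; lia.
Qed.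

(** For integers, [(a - b) (a - b - 1) >= 0]. *)
Lemma sq_convex a b : (2 * b + 1) * a <= a * a + b * (b + 1).
Proof.
have dd d : d <= d * d by case: d => // d; rewrite leq_pmulr.
case: (leqP a b) => [/subnK <-|/subnK <-].
  by move: (b - a) => d; have := dd d; lia.
by move: (a - b.+1) => d; have := dd d; lia.
Qed.

(** [sq_convex] is applied to each part, but to [a j + 1] at part [j]; this shift yields the extra
    [2 * b], matching the term [- b] in [eY]. *)
Lemma sum_sq_lower p n (a : 'I_p -> nat) (b : nat) j : \sum_i a i = n ->
  (2 * b + 1) * n + 2 * b <= \sum_i a i ^ 2 + 2 * a j + p * b * (b + 1).
Proof.
move=> <-; have E : p * b * (b + 1) = \sum_(i < p) b * (b + 1).
  by rewrite sum_nat_const card_ord mulnA.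
rewrite E big_distrr /= (bigD1 j) // [X in _ <= X + _ + _](bigD1 j) // [X in _ <= _ + X](bigD1 j) //=.
have H1 : (2 * b + 1) * a j + 2 * b <= a j ^ 2 + 2 * a j + b * (b + 1).
  by have := sq_convex (a j).+1 b; rewrite -mulnn; lia.
have H2 : \sum_(i < p | i != j) (2 * b + 1) * a i <= \sum_(i < p | i != j) a i ^ 2 + \sum_(i < p | i != j) b * (b + 1).
  rewrite -big_split; apply: leq_sum => i _ /=.
  by rewrite -mulnn; exact: sq_convex.
by rewrite addnAC; apply: leq_trans (leq_add H1 H2) _; apply: eq_leq; ring.
Qed.

(** The complete [p]-partite graph with parts [a i] has [(n ^ 2 - \sum_i a i ^ 2) / 2] edges; losing
    [a j] of them and gaining one leaves at most [eY p n]. *)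
Lemma eY_upper p n (a : 'I_p -> nat) j : 2 <= p -> \sum_i a i = n ->
  n * n + 2 <= 2 * eY p n + \sum_i a i ^ 2 + 2 * a j.
Proof. by move=> p2 an; have := eY_closed n p2; have := sum_sq_lower (n %/ p) j an; lia. Qed.

Lemma eY_lower p n : 2 <= p -> (p - 1) * (n * n) <= 2 * p * eY p n + p * n.
Proof.
move=> p2; have := eY_closed n p2; have := leq_trunc_div n p.
move: (n %/ p) (eY p n) => b e H1 H2.
have : p * (2 * e + (2 * b + 1) * n + 2 * b) = p * (n * n + p * b * (b + 1) + 2) by rewrite H2.
have := (nat_Cauchy n (b * p)).1; rewrite -!mulnn => S; have T : 2 * (b * p) <= p * (b * p) by rewrite leq_mul2r p2 orbT.
have -> : (p - 1) * (n * n) = p * (n * n) - n * n by rewrite mulnBl mul1n.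
lia.
Qed.

(** An equality for [c <= n]; beyond that the truncated [n - c] is 0 and only the inequality
    survives. *)
Lemma sq_dev n c : 2 * n * c + (n - c) ^ 2 <= c * c + n * n.
Proof.
case: (leqP c n) => [/subnK <-|H]; first by rewrite addnK; move: (n - c) => d; lia.
by rewrite (eqP (ltnW H)) -!mulnn; have := (nat_Cauchy n c).1; lia.
Qed.

(* Variance bound: [p ^ 2 * sum (a i) ^ 2 - p * n ^ 2 = sum (p * a i - n) ^ 2]. *)
Lemma sum_sq_dev p n (a : 'I_p -> nat) j : \sum_i a i = n ->
  p * (n * n) + (n - p * a j) ^ 2 <= p * p * \sum_i a i ^ 2.
Proof.
move=> an.
have : 2 * p * n * \sum_i a i + (n - p * a j) ^ 2 <= p * p * \sum_i a i ^ 2 + \sum_(i < p) n * n.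
  rewrite !big_distrr /= (bigD1 j) // [X in _ <= X + _](bigD1 j) // [X in _ <= _ + X](bigD1 j) //=.
  have H1 : 2 * p * n * a j + (n - p * a j) ^ 2 <= p * p * a j ^ 2 + n * n.
    have -> : p * p * a j ^ 2 = (p * a j) * (p * a j) by nia.
    have -> : 2 * p * n * a j = 2 * n * (p * a j) by nia.
    exact: sq_dev.
  have H2 : \sum_(i < p | i != j) 2 * p * n * a i <= \sum_(i < p | i != j) p * p * a i ^ 2 + \sum_(i < p | i != j) n * n.
    rewrite -big_split; apply: leq_sum => i _ /=.
    have -> : p * p * a i ^ 2 = (p * a i) * (p * a i) by nia.
    have -> : 2 * p * n * a i = 2 * n * (p * a i) by nia.
    by apply: leq_trans (sq_dev n _); exact: leq_addr.
  by rewrite addnAC; apply: leq_trans (leq_add H1 H2) _; apply: eq_leq; ring.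
rewrite an sum_nat_const card_ord; lia.
Qed.

(** * One vertex away from p-partite *)

(** Twice the number of edges, over any finite type, so that deleting a vertex requires no
    renumbering. *)
Definition degsum (V : finType) (G : rel V) : nat := \sum_x \sum_y (G x y : nat).

Section Core.
Variables (V : finType) (G : rel V) (p q t : nat).
Hypotheses (Gsym : symmetric G) (Girr : irreflexive G).
Hypotheses (nb : ~ contains_subgraph (@book p q) G) (p3 : 3 <= p) (q0 : 0 < q).
Hypotheses (nKl : 20 * p ^ 3 * t <= #|V|) (nKu : #|V| <= 40 * p ^ 3 * t) (tK : 160 * p ^ 3 + q <= t).
Variables (f : V -> 'I_p) (d : V).
Hypothesis fproper : forall x y, x != d -> y != d -> G x y -> f x != f y.

Let a j := #|[set x | f x == j]|.
Let l j := #|[set y | (f y == j) && G d y]|.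
Let i := f d.
Let m x y := (f y != f x) && ~~ G x y.
(** Ordered pairs: every missing edge between different classes contributes 2. *)
Let mis := \sum_x \sum_y (m x y : nat).

Hypothesis lmin : forall j, l i <= l j.
Hypothesis ncol : ~ colorable p G.

Lemma sum_class_sizes : \sum_j a j = #|V|.
Proof.
rewrite -sum1_card (partition_big f xpredT) //=; apply: eq_bigr => j _.
by rewrite /a -sum1dep_card.
Qed.

(** An ordered pair is an edge, a missing cross pair, or lies inside a class. The only overlap is
    the edges inside a class; these all contain [d], which makes [2 * l i] ordered pairs. *)
Lemma degsum_count : degsum G + mis + \sum_j a j ^ 2 <= #|V| * #|V| + 2 * l i.
Proof.
have E1 : \sum_j a j ^ 2 = \sum_x \sum_y (f x == f y : nat).
  rewrite (partition_big f xpredT) //=; apply: eq_bigr => j _.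
  rewrite -mulnn {1}/a -sum1dep_card big_distrl /=; apply: eq_bigr => x /eqP fx.
  by rewrite mul1n /a card_sum_indicator; apply: eq_bigr => y _; rewrite fx eq_sym.
have E2 : l i = \sum_x \sum_y [&& x == d, f y == i & G d y].
  rewrite (bigD1 d) //= [X in _ + X]big1 ?addn0; last by move=> x /negbTE ->; rewrite big1.
  by rewrite /l card_sum_indicator eqxx.
have E3 : l i = \sum_x \sum_y [&& y == d, f x == i & G d x] by rewrite exchange_big.
have E4 : #|V| * #|V| = \sum_(x : V) \sum_(y : V) 1 by rewrite !sum_nat_const !muln1.
rewrite E1 mul2n -addnn {1}E2 E3 E4 /degsum /mis -!big_split; apply: leq_sum => x _.
rewrite -!big_split; apply: leq_sum => y _ /=; rewrite /m.
case: (eqVneq (f x) (f y)) => [fxy|fxy] /=; last by case: (G x y).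
case Gxy: (G x y) => //=.
have [xd|xd] := eqVneq x d; first by rewrite -xd Gxy -fxy xd eqxx.
have [yd|yd] := eqVneq y d; first by rewrite -yd Gsym Gxy fxy yd eqxx.
by have := fproper xd yd Gxy; rewrite fxy eqxx.
Qed.

Lemma half_missing (P : rel V) :
  (forall x y, P x y -> m x y) -> (forall x y, P x y -> ~~ P y x) ->
  2 * \sum_x \sum_y (P x y : nat) <= mis.
Proof.
move=> Pm Pa; rewrite mul2n -addnn [X in _ + X]exchange_big /mis -!big_split.
apply: leq_sum => x _; rewrite -big_split; apply: leq_sum => y _ /=.
case Pxy: (P x y); case Pyx: (P y x) => //=.
- by have := Pa _ _ Pxy; rewrite Pyx.
- by have := Pm _ _ Pxy; rewrite /m => ->.
- by have := Pm _ _ Pyx; rewrite /m Gsym eq_sym => ->.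
Qed.

Hypothesis big : 2 * eY p #|V| < degsum G.

(** [degsum_count] against [eY_upper]. The index [j] is free, so the bound can be taken at the class
    whose missing pairs are being counted. *)
Lemma mis_upper j : mis + 3 <= 2 * l i + 2 * a j.
Proof.
have := degsum_count; have := @eY_upper p #|V| a j (ltnW p3) sum_class_sizes; lia.
Qed.

Lemma l_le_a j : l j <= a j.
Proof. by apply/subset_leq_card/subsetP => x; rewrite !inE => /andP[]. Qed.

Lemma a_le j : a j <= #|V|.
Proof. exact: max_card. Qed.

Lemma cubeE : p ^ 3 = p * (p * p).
Proof. by rewrite !expnS muln1. Qed.

(** The sum of squares is within [O(n)] of its minimum, so [sum_sq_dev] gives
    [(n - p * a j) ^ 2 <= 3 p ^ 2 n], which is at most [(p * t) ^ 2] because [n <= 40 p ^ 3 t] and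
    [160 p ^ 3 <= t]. *)
Lemma class_size j : #|V| <= p * a j + p * t.
Proof.
have := degsum_count; have := eY_lower #|V| (ltnW p3); have := @sum_sq_dev p #|V| a j sum_class_sizes.
have := leq_trans (l_le_a i) (a_le i); move: nKu tK; rewrite cubeE.
move: #|V| (a j) (l i) (\sum_j _) (eY _ _) big => n aj k s e big' nk tK' H0 H1 H2 H3.
have E1 : s + 2 * e <= n * n + 2 * n by lia.
have E2 : p * p * s + 2 * p * p * e <= p * p * (n * n + 2 * n).
  by apply: leq_trans (leq_mul (leqnn (p * p)) E1); apply: eq_leq; ring.
have E3 : p * ((p - 1) * (n * n)) <= p * (2 * p * e + p * n) by rewrite leq_mul2l H2 orbT.
have E4 : p * ((p - 1) * (n * n)) + p * (n * n) = p * p * (n * n).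
  by rewrite -mulnDr -mulSnr -mulnA; congr (_ * (_ * _)); lia.
have E5 : (n - p * aj) ^ 2 <= 3 * (p * p * n) by lia.
have E6 : 3 * (p * p * n) <= (p * t) ^ 2.
  have : p * p * (3 * n) <= p * p * (t * t).
    rewrite leq_mul2l; apply/orP; right.
    apply: leq_trans (leq_mul (_ : 160 * (p * (p * p)) <= t) (leqnn t)); lia.
  by rewrite -mulnn; lia.
have := leq_trans E5 E6; rewrite leq_sqr; lia.
Qed.

Let A := [set x | \sum_y (m x y : nat) <= t].

Lemma few_bad : #|~: A| <= t.
Proof.
have H : #|~: A| * t <= mis.
  rewrite /mis (bigID (mem A)) /=; apply: leq_trans (leq_addl _ _).
  rewrite -sum_nat_const (eq_bigl (fun x => x \notin A)); last by move=> x; rewrite in_setC.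
  by apply: leq_sum => x; rewrite inE -ltnNge; apply: ltnW.
have := mis_upper i; have := l_le_a i; have := a_le i.
have t0 : 0 < t by lia.
move=> H1 H2 H3; rewrite -(leq_pmul2r t0); apply: leq_trans H _.
(* The constant 160 is [4 * 40]: here [mis <= 4 n] and [n <= 40 p ^ 3 t]. *)
have : 160 * p ^ 3 * t <= t * t by rewrite leq_mul2r; apply/orP; right; lia.
lia.
Qed.

Lemma A_near : {in A, forall x, #|[set y in A | (f y != f x) && ~~ G x y]| <= t}.
Proof.
move=> x; rewrite inE => H; apply: leq_trans H; rewrite -card_sum_indicator.
by apply/subset_leq_card/subsetP => y; rewrite [y \in _]in_set [in X in _ -> X]in_set => /and3P [_ ? ?]; apply/andP.
Qed.

(** [greedy_gap] inside the typical vertices [A]; the at most [t] others are absorbed in the error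
    term. *)
Lemma class_gap (J : {set 'I_p}) (Q : {set V}) :
  clique G Q -> #|Q| + #|J| = p.+1 -> J != set0 ->
  exists2 j, j \in J & a j <= #|[set y | (f y == j) && (y \notin common G Q)]| + (p + 2) * t.
Proof.
move=> cQ QJ J0; have [j jJ H] := greedy_gap Gsym Girr nb q0 A_near cQ QJ J0.
exists j => //; have Hb := few_bad.
have : a j <= #|[set y | (f y == j) && (y \notin common G Q)]| + #|[set y in A | (f y == j) && (y \in common G Q)]| + #|~: A|.
  apply: leq_trans (leq_trans (leq_card_setU _ _) (leq_add (leq_card_setU _ _) (leqnn _))).
  apply/subset_leq_card/subsetP => y; rewrite in_set => fy; rewrite !in_setU in_setC.
  rewrite [y \in [set _ | _]]in_set [y \in [set _ in _ | _]]in_set fy /=.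
  by case: (y \in A); case: (y \in common G Q).
lia.
Qed.

Lemma lmin_gt0 : 0 < l i.
Proof.
rewrite lt0n; apply/negP => /eqP l0; apply: ncol; exists f => x y Gxy.
have nd z : G d z -> f d != f z.
  move=> Gdz; apply/negP => /eqP E; have : z \in [set y | (f y == i) && G d y] by rewrite inE Gdz -E eqxx.
  by rewrite (cards0_eq l0) inE.
have [xd|xd] := eqVneq x d; first by rewrite xd nd // -xd.
have [yd|yd] := eqVneq y d; first by rewrite yd eq_sym nd // -yd Gsym.
exact: fproper.
Qed.

(** By [class_gap] from [d] alone, [d] misses almost all of some class, and class [i] holds no more
    neighbours of [d] than that one. *)
Lemma lmin_small : l i <= (p + 2) * t.
Proof.
have [|||j _] := @class_gap setT [set d].
- by move=> x y /set1P -> /set1P ->; rewrite eqxx.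
- by rewrite cards1 cardsT card_ord.
- by apply/set0Pn; exists i.
have := lmin j.
have : l j + #|[set y | (f y == j) && (y \notin common G [set d])]| <= a j.
  rewrite /l /a !card_sum_indicator -big_split; apply: leq_sum => y _ /=.
  case: (f y == j) => //=; rewrite inE.
  case: (boolP (G d y)) => //= Gdy; last by case: (~~ _).
  by rewrite (_ : [forall _ in _, _]) //; apply/forall_inP => x /set1P ->.
lia.
Qed.

Lemma core_contradiction : False.
Proof.
have [x0] : exists x, x \in [set y | (f y == i) && G d y] by apply/card_gt0P; exact: lmin_gt0.
rewrite inE => /andP [/eqP fx0 dx0].
have [|||j] := @class_gap (~: [set i]) [set d; x0].
- by move=> x y /set2P [->|->] /set2P [->|->]; rewrite ?eqxx // => _; rewrite // Gsym.
- rewrite cards2 cardsC1 card_ord; case: eqVneq dx0 => [->|_ _]; first by rewrite Girr.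
  lia.
- by rewrite -card_gt0 cardsC1 card_ord; lia.
rewrite in_setC in_set1 => ji Hj.
have Hup := mis_upper j.
have Pnot (Q : {set V}) y : y \notin common G Q -> exists2 x, x \in Q & ~~ G x y.
  by rewrite inE => /forall_inPn [x]; exists x.
case: (boolP [exists x, exists y, [&& f x == i, G d x, f y == j, G d y & G x y]]); last first.
  move=> /existsPn Hno.
  pose P x y := m x y && ((f x == i) && (f y == j)).
  have HP : 2 * \sum_x \sum_y (P x y : nat) <= mis.
    apply: half_missing => x y; rewrite /P; first by case/andP.
    case/and3P => _ /eqP -> /eqP ->; rewrite (negbTE ji) /=; by rewrite andbF.
  (* The missing pairs are [d] with its non-neighbours in class [j], and all pairs of neighbours of
     [d] in classes [i] and [j]. *)
  have HS : (a j - l j) + l i * l j <= \sum_x \sum_y (P x y : nat).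
    rewrite (bigD1 d) //=; apply: leq_add.
      have : a j <= l j + \sum_y (P d y : nat); last lia.
      rewrite /a /l !card_sum_indicator -big_split; apply: leq_sum => y _ /=.
      rewrite /P /m -/i eqxx /=; case: eqVneq => // ->; rewrite ji /=.
      by case: (G d y).
    rewrite (bigID (fun x => (f x == i) && G d x)) /=; apply: leq_trans (leq_addr _ _).
    rewrite /l -[X in X * _]sum1dep_card big_distrl /=.
    rewrite [X in _ <= X](eq_bigl (fun x => (f x == i) && G d x)); last first.
      by move=> x /=; case: eqVneq => [->|] //=; rewrite Girr andbF.
    apply: leq_sum => x /andP [fx dx]; rewrite mul1n card_sum_indicator.
    apply: leq_sum => y _; have /existsPn/(_ y) := Hno x; rewrite fx dx /= /P /m (eqP fx) eqxx.
    by case: eqVneq => //= ->; rewrite ji /=; case: (G d y) => //= ->.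
  have L0 := lmin_gt0; have Lj := lmin j; have La := l_le_a j.
  move: HP HS Hup La L0 Lj; move: (\sum_x _) mis (a j) (l j) (l i) => s M aj lj k HP HS Hup La L0 Lj.
  have : k + lj <= k * lj + 1 by case: k L0 lj Lj {HP HS Hup La} => // k _ [|lj] // _; rewrite mulSn mulnS; lia.
  lia.
case/existsP => x' /existsP [y' /and5P [/eqP fx' dx' /eqP fy' dy' xy']].
have dx'N : d != x' by apply: contraTneq dx' => ->; rewrite Girr.
have dy'N : d != y' by apply: contraTneq dy' => ->; rewrite Girr.
have xy'N : x' != y' by apply: contraTneq xy' => ->; rewrite Girr.
pose C : {set 'I_p} := ~: [set i; j].
have cij : 2 + #|C| = p.
  by rewrite -[RHS]card_ord -(cardsC [set i; j]) cards2 [i == j]eq_sym ji.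
(* [d], [x'], [y'] form a triangle; a third class exists as [p >= 3], and almost no vertex of some
   such class [k] is joined to all three. *)
have [|||k] := @class_gap C (d |: [set x'; y']).
- move=> x y /setU1P [->|/set2P [->|->]] /setU1P [->|/set2P [->|->]]; rewrite ?eqxx // => _; by rewrite // Gsym.
- rewrite cardsU1 in_set2 cards2 xy'N (negbTE dx'N) (negbTE dy'N).
  by move: cij; rewrite /=; lia.
- by rewrite -card_gt0; lia.
rewrite /C in_setC in_set2 negb_or => /andP [ki kj] Hk.
(* Missing pairs ending in class [j] or [k] are disjoint families, so [mis] is at least about
   [2 * (a j + a k)]; [mis_upper] then makes [a k] too small for [class_size]. *)
pose P x y := m x y && ((f x == i) && (f y == j) || (f y == k)).
have HP : 2 * \sum_x \sum_y (P x y : nat) <= mis.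
  apply: half_missing => x y; rewrite /P; first by case/andP.
  case/andP; rewrite /m => /andP [fxy _] /orP [/andP [/eqP fx /eqP fy]|/eqP fy].
    by rewrite fx fy (negbTE ji) /= [i == k]eq_sym (negbTE ki) andbF.
  by rewrite fy (negbTE ki) /= -fy [f x == _]eq_sym (negbTE fxy) andbF.
have HS : #|[set y | (f y == j) && (y \notin common G [set d; x0])]| +
   #|[set y | (f y == k) && (y \notin common G (d |: [set x'; y']))]| <= \sum_x \sum_y (P x y : nat).
  rewrite exchange_big /= !card_sum_indicator -big_split; apply: leq_sum => y _ /=.
  have [fy|_] := eqVneq (f y) j.
    rewrite fy [j == k]eq_sym (negbTE kj) addn0 /=; case: (boolP (y \in _)) => //= /Pnot [x xQ xy].
    have fx : f x = i by case/set2P: xQ => ->.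
    by rewrite (bigD1 x) //= /P /m fx fy ji xy !eqxx.
  have [fy|_] //= := eqVneq (f y) k.
  rewrite add0n; case: (boolP (y \in _)) => //= /Pnot [x xQ xy].
  rewrite (bigD1 x) //= /P /m fy xy eqxx orbT andbT /= (_ : k != f x) //.
  by case/setU1P: xQ => [->|/set2P [->|->]] //; rewrite ?fx' ?fy'.
have Lk := lmin_small; have Sk := class_size k; have := nKl; rewrite cubeE => nK.
have X1 : a k <= 3 * (p + 2) * t by lia.
have X2 : p * a k <= p * (3 * (p + 2) * t) by rewrite leq_mul2l X1 orbT.
have X3 : p * p * t * 3 <= p * (p * p) * t.
  by rewrite (_ : p * (p * p) * t = p * p * t * p) ?leq_mul2l ?p3 ?orbT //; ring.
have X4 : p * t * 3 <= p * p * t.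
  by rewrite (_ : p * p * t = p * t * p) ?leq_mul2l ?p3 ?orbT //; ring.
have X5 : 0 < p * t by rewrite muln_gt0; lia.
lia.
Qed.

End Core.

(** * Progressive induction *)

Lemma degsum_le_of_colorable_delete (V : finType) (G : rel V) (p q t : nat) (d : V) (f : V -> 'I_p) :
  symmetric G -> irreflexive G -> ~ contains_subgraph (@book p q) G -> 3 <= p -> 0 < q ->
  20 * p ^ 3 * t <= #|V| -> #|V| <= 40 * p ^ 3 * t -> 160 * p ^ 3 + q <= t ->
  (forall x y, x != d -> y != d -> G x y -> f x != f y) -> ~ colorable p G ->
  degsum G <= 2 * eY p #|V|.
Proof.
move=> Gsym Girr nb p3 q0 nKl nKu tK fproper ncol; rewrite leqNgt; apply/negP => big.
pose l j := #|[set y | (f y == j) && G d y]|.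
have i0 : 'I_p by exists 0; lia.
case: (arg_minnP l (erefl : xpredT i0)) => i _ lmin.
(* Recolouring [d] leaves the counts [l] unchanged, since [d] is not its own neighbour. *)
pose g x := if x == d then i else f x.
have gd : g d = i by rewrite /g eqxx.
have El j : #|[set y | (g y == j) && G d y]| = l j.
  apply: eq_card => y; rewrite !inE /g.
  by case: (eqVneq y d) => // ->; rewrite Girr !andbF.
apply: (@core_contradiction V G p q t Gsym Girr nb p3 q0 nKl nKu tK g d) => //.
- by move=> x y xd yd; rewrite /g (negbTE xd) (negbTE yd); apply: fproper.
- by move=> j; rewrite gd !El lmin.
Qed.

Section Delete.
Variables (V : finType) (G : rel V) (v : V).
Hypotheses (Gsym : symmetric G) (Girr : irreflexive G).

Definition del_graph : rel {x in predC1 v} := fun x y => G (val x) (val y).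

Lemma card_del : #|V| = #|{: {x in predC1 v}}|.+1.
Proof. by rewrite card_sig (cardC1 v) prednK //; apply/card_gt0P; exists v. Qed.

Lemma del_book_free p q :
  ~ contains_subgraph (@book p q) G -> ~ contains_subgraph (@book p q) del_graph.
Proof.
move=> nb [f [fi fh]]; apply: nb; exists (val \o f); split => //.
exact: inj_comp val_inj fi.
Qed.

Lemma degsum_del : degsum G <= degsum del_graph + 2 * #|[set y | G v y]|.
Proof.
have -> : degsum del_graph = \sum_(x in predC1 v) \sum_(y in predC1 v) (G x y : nat).
  by rewrite [RHS]big_sub; apply: eq_bigr => x _; rewrite [RHS]big_sub.
rewrite /degsum (bigD1 v) //= -card_sum_indicator.
under eq_bigr => x _ do rewrite (bigD1 v) //=.
rewrite big_split /= mul2n -addnn addnA [X in X <= _]addnC.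
apply: leq_add => //; rewrite leq_add2l card_sum_indicator [X in _ <= X](bigD1 v) //= Girr.
by apply: leq_sum => x _; rewrite Gsym.
Qed.

Lemma colorable_del p : 0 < p -> colorable p del_graph ->
  exists f : V -> 'I_p, forall x y, x != v -> y != v -> G x y -> f x != f y.
Proof.
move=> p0 [f fP]; exists (fun x => if insub x is Some u then f u else Ordinal p0).
move=> x y xv yv xy; rewrite (insubT (fun x => x \in predC1 v) xv) (insubT (fun x => x \in predC1 v) yv).
exact: fP.
Qed.

End Delete.

(* Deleting a vertex of small degree lowers the excess over [2 * eY] by at least 2, so the
   trivial bound [N ^ 2] on the excess at size [N] is used up after [N ^ 2] further vertices. *)
Lemma degsum_progressive p q k (V : finType) (G : rel V) :
  3 <= p -> 0 < q ->
  let N := 20 * p ^ 3 * (160 * p ^ 3 + q) in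
  #|V| = N + k -> symmetric G -> irreflexive G ->
  ~ contains_subgraph (@book p q) G -> ~ colorable p G ->
  degsum G <= 2 * eY p #|V| + 2 * (N * N - k).
Proof.
move=> p3 q0 N; have p0 : 0 < p by lia.
have c0 : 0 < 20 * p ^ 3 by rewrite muln_gt0 expn_gt0 p0.
elim: k => [|k IH] in V G * => cV Gsym Girr nb ncol.
  have : degsum G <= #|V| * #|V|.
    rewrite -sum_nat_const; apply: leq_sum => x _.
    by rewrite -card_sum_indicator max_card.
  rewrite cV; lia.
(* Then [n] lies between [20 p ^ 3 t] and [40 p ^ 3 t], and [n >= N] gives [t >= 160 p ^ 3 + q]. *)
pose t := #|V| %/ (20 * p ^ 3).
have tl : 20 * p ^ 3 * t <= #|V| by rewrite mulnC leq_trunc_div.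
have tK : 160 * p ^ 3 + q <= t.
  by rewrite /t leq_divRL // mulnC cV leq_addr.
have tu : #|V| <= 40 * p ^ 3 * t.
  have := ltn_ceil #|V| c0; rewrite -/t mulSn => H.
  have : 20 * p ^ 3 <= t * (20 * p ^ 3) by rewrite leq_pmull //; lia.
  by lia.
case: (boolP [forall x, p * #|[set y | ~~ G x y]| <= #|V| + p * t]) => [/forallP md|/forallPn [v]].
  case: ncol; apply: (@colorable_of_min_degree _ _ p q t) => //; lia.
rewrite -ltnNge => Hv.
case: (leqP (degsum G) (2 * eY p #|V|)) => [H|H]; first exact: leq_trans H (leq_addr _ _).
have nc' : ~ colorable p (del_graph G (v := v)).
  move=> /(colorable_del p0) [f fP].
  by have := degsum_le_of_colorable_delete Gsym Girr nb p3 q0 tl tu tK fP ncol; rewrite leqNgt H.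
have cD := card_del v.
have H1 : degsum (del_graph G (v := v)) <= 2 * eY p #|{: {x in predC1 v}}| + 2 * (N * N - k).
  apply: IH nc' => //; first by apply: succn_inj; rewrite -addnS -cV cD.
  - by move=> x y; rewrite /del_graph Gsym.
  - by move=> x; rewrite /del_graph Girr.
  - exact: del_book_free.
have H2 := degsum_del v Gsym Girr.
have H3 : #|[set y | G v y]| + #|[set y | ~~ G v y]| = #|V|.
  rewrite -(cardsC [set y | G v y]); congr (_ + _).
  by apply: eq_card => y; rewrite !inE.
move: H1 H2 => H1 H2; rewrite [in eY _ _]cD eYS -cD; have D : p * (#|V| %/ p) <= #|V| by rewrite mulnC leq_trunc_div.
(* The degree of [v] is at most [n - 1 - n %/ p - t], while [eY] drops by [n - 1 - n %/ p]; the
   excess of [G] is thus at least [2 * t] below that of [G - v]. *)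
have H4 : #|V| %/ p + t < #|[set y | ~~ G v y]|.
  by rewrite -(ltn_pmul2l p0) mulnDr; apply: leq_ltn_trans Hv; rewrite leq_add2r.
move: H1 H2 H3 H4 cD cV; move: (degsum _) (degsum _) (_ %/ _) (eY _ _) => s s' b e H1 H2 H3 H4 cD cV.
lia.
Qed.

Lemma degsum_num_edges n (G : rel 'I_n) : symmetric G -> irreflexive G ->
  degsum G = 2 * num_edges G.
Proof.
move=> Gsym Girr; rewrite /num_edges card_sum_indicator.
rewrite -(pair_bigA _ (fun x y : 'I_n => ((x < y) && G x y : nat))) /=.
rewrite mul2n -addnn [X in _ + X]exchange_big -big_split; apply: eq_bigr => x _.
rewrite -big_split; apply: eq_bigr => y _ /=; rewrite (Gsym y x).
by case: ltngtP => [_|_|/val_inj ->] /=; rewrite ?addn0 ?Girr.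
Qed.

(** From [N + N * N] vertices on, the allowance [N * N - k] is 0. *)
Lemma num_edges_upper p q n (G : rel 'I_n) : 3 <= p -> 0 < q ->
  let N := 20 * p ^ 3 * (160 * p ^ 3 + q) in N + N * N <= n ->
  simple_graph G -> non_p_partite p G -> book_free p q G -> num_edges G <= eY p n.
Proof.
move=> p3 q0 N Nn /andP [/forallP irr /forallP sym] ncol nb.
have Girr : irreflexive G by move=> x; apply: negbTE.
have Gsym : symmetric G by move=> x y; have /forallP/(_ y)/eqP := sym x.
have cn : #|'I_n| = N + (n - N) by rewrite card_ord subnKC //; lia.
have := degsum_progressive p3 q0 cn Gsym Girr nb ncol.
rewrite card_ord degsum_num_edges // -/N; lia.
Qed.

(** * The graph Y_p(n) *)

Lemma Ycls_eq p v r : 0 < v -> r < p -> (Ycls p v == r) = (v == r.+1 %[mod p]).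
Proof.
case: v => // v _ rp; rewrite /Ycls /= -addn1 -(addn1 r) eqn_modDr.
by rewrite [r %% p]modn_small.
Qed.

Lemma Ycls_lt p v : 0 < p -> Ycls p v < p.
Proof. exact: ltn_pmod. Qed.

Lemma Ycls_small p v : v <= p -> 0 < v -> Ycls p v = v.-1.
Proof. by move=> vp v0; rewrite /Ycls modn_small //; lia. Qed.

Lemma Ycls_addp p v : 0 < v -> Ycls p (p + v) = Ycls p v.
Proof. by case: v => // v _; rewrite /Ycls addnS /= modnDl. Qed.

Lemma Y_adj_sym p x y : Y_adj p x y = Y_adj p y x.
Proof.
rewrite /Y_adj eq_sym [Ycls p x == Ycls p y]eq_sym.
case: (eqVneq x 0) => [->|_]; case: (eqVneq y 0) => [->|_] //.
by congr (_ && (_ && ~~ _)); rewrite orbC; congr (_ || _); apply: andbC.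
Qed.

Lemma Y_adj0 p y : 0 < y ->
  Y_adj p 0 y = [|| (Ycls p y != p.-1) && (Ycls p y != p.-2), y == p | y == p.-1].
Proof. by case: y => // y _; rewrite /Y_adj /= orbA. Qed.

Lemma Y_adj_pos p x y : 0 < x -> 0 < y ->
  Y_adj p x y = (Ycls p x != Ycls p y) &&
    ~~ [|| (x == p) && (y == p.-1) | (x == p.-1) && (y == p)].
Proof.
case: x => // x _; case: y => // y _; rewrite /Y_adj /=.
by case: (eqVneq x.+1 y.+1) => [->|//]; rewrite eqxx.
Qed.

Lemma Yp_simple p n : simple_graph (@Yp p n).
Proof.
apply/andP; split; first by apply/forallP => x; rewrite /Yp /Y_adj eqxx.
by apply/forallP => x; apply/forallP => y; rewrite /Yp Y_adj_sym.
Qed.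

(** The vertices [0], [p - 1], [2p], [2p - 1], [p] form a 5-cycle, completely joined to the clique
    [1, ..., p - 2]. The clique leaves only two colours for the odd cycle. *)
Lemma Yp_not_p_partite p n : 3 <= p -> 2 * p < n -> non_p_partite p (@Yp p n).
Proof.
case: n => // n p3 pn [f fP].
pose c k := f (inord k).
have cP a b : a <= 2 * p -> b <= 2 * p -> Y_adj p a b -> c a != c b.
  move=> ap bp ab; apply: fP; rewrite /Yp !inordK //; lia.
have E0 k : 0 < k <= p -> Ycls p k = k.-1 by case/andP => *; apply: Ycls_small.
have E1 : Ycls p (2 * p) = p.-1 by rewrite mul2n -addnn Ycls_addp ?E0 //; lia.
have E2 : Ycls p (2 * p).-1 = p.-2.
  rewrite (_ : (2 * p).-1 = p + p.-1); last by lia.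
  by rewrite Ycls_addp ?E0 //; lia.
have J0 : c 0 <> c p.-1 by apply/eqP; apply: cP; rewrite ?Y_adj0 ?E0; lia.
have J1 : c p.-1 <> c (2 * p) by apply/eqP; apply: cP; rewrite ?Y_adj_pos ?E1 ?E0; lia.
have J2 : c (2 * p) <> c (2 * p).-1 by apply/eqP; apply: cP; rewrite ?Y_adj_pos ?E1 ?E2; lia.
have J3 : c (2 * p).-1 <> c p by apply/eqP; apply: cP; rewrite ?Y_adj_pos ?E2 ?E0; lia.
have J4 : c p <> c 0 by apply/eqP; rewrite eq_sym; apply: cP; rewrite ?Y_adj0 ?E0; lia.
pose K := [set c k.+1 | k : 'I_(p - 2)].
have cardK : #|K| = p - 2.
  rewrite card_imset ?card_ord // => k k' E; apply: val_inj; apply/eqP; apply: contraT => kk'.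
  have kp := ltn_ord k; have kp' := ltn_ord k'.
  have kN : (k : nat) != k' by exact: kk'.
  have : c k.+1 != c k'.+1 by apply: cP; rewrite ?Y_adj_pos ?E0 /=; lia.
  by rewrite E eqxx.
have /cards2P [s [s' [_ Ks]]] : #|~: K| == 2.
  by have := cardsC K; rewrite cardK card_ord; lia.
have inK z : z <= 2 * p -> (forall k, 0 < k < p.-1 -> Y_adj p z k) -> c z \in [set s; s'].
  move=> zp H; rewrite -Ks in_setC; apply/imsetP => [[k _ E]].
  have kp := ltn_ord k.
  have := cP z k.+1; rewrite E eqxx => F; apply: notF; apply: F => //; first by lia.
  by apply: H; lia.
have I0 : c 0 \in [set s; s'].
  by apply: inK => // k kp; rewrite Y_adj0 ?E0; lia.
have I1 : c p.-1 \in [set s; s'].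
  by apply: inK => [|k kp]; rewrite ?Y_adj_pos ?E0; lia.
have I2 : c p \in [set s; s'].
  by apply: inK => [|k kp]; rewrite ?Y_adj_pos ?E0; lia.
have I3 : c (2 * p).-1 \in [set s; s'].
  by apply: inK => [|k kp]; rewrite ?Y_adj_pos ?E2 ?E0; lia.
have I4 : c (2 * p) \in [set s; s'].
  by apply: inK => [|k kp]; rewrite ?Y_adj_pos ?E1 ?E0; lia.
move: J0 J1 J2 J3 J4.
by case/set2P: I0 => ->; case/set2P: I1 => ->; case/set2P: I4 => ->;
  case/set2P: I3 => ->; case/set2P: I2 => ->; move=> *; congruence.
Qed.

(** [B_{p,1}] is [K_{p+1}], so it suffices to colour the image of such a clique with [p]
    distinct-valued colours [g]. *)
Lemma Yp_K_free p n : 3 <= p -> book_free p 1 (@Yp p n).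
Proof.
move=> p3 [f [_ fh]].
have adj a b : a != b -> Y_adj p (f a) (f b).
  case: a b => [a|a] [b|b] // ab; apply: fh => //=.
  by case/eqP: ab; rewrite !ord1.
have p0 : 0 < p by lia.
suff [g gi] : exists g : 'I_p + 'I_1 -> 'I_p, injective g.
  by have := leq_card g gi; rewrite card_sum !card_ord; lia.
suff [g gP] : exists g : nat -> nat, forall a b, a != b -> (g (f a) < p) && (g (f a) != g (f b)).
  pose h (a : 'I_p + 'I_1) : 'I_p := insubd (Ordinal p0) (g (f a)).
  have nt a : exists b : 'I_p + 'I_1, a != b.
    by case: a => a; [exists (inr ord0)|exists (inl (Ordinal p0))].
  have hE a : val (h a) = g (f a).
    by have [b ab] := nt a; rewrite val_insubd; case/andP: (gP a b ab) => ->.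
  exists h => a b /(congr1 val); rewrite !hE => E; apply/eqP; apply: contraT => /gP.
  by rewrite E eqxx andbF.
case: (boolP [exists a, (f a : nat) == 0]) => [/existsP [a0 /eqP fa0]|/existsPn no0]; last first.
  exists (Ycls p) => a b ab; rewrite Ycls_lt //=.
  have := adj _ _ ab; rewrite Y_adj_pos ?lt0n ?no0 //.
  by case/andP.
(* A clique through [u_0] meets the two smallest classes only in [u_1 = p] and [u_2 = p - 1]. These
   are not adjacent, so [u_1] can take the colour [p - 2] of [u_2], freeing [p - 1] for [u_0]. *)
exists (fun x => if x == 0 then p.-1 else if x == p then p.-2 else Ycls p x).
have pos a : a != a0 -> 0 < f a /\ Y_adj p 0 (f a).
  move=> aa; have := adj _ _ aa; rewrite Y_adj_sym fa0 => H; split => //.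
  by rewrite lt0n; apply: contraTneq H => ->; rewrite /Y_adj eqxx.
have Ep : Ycls p p.-1 = p.-2 by apply: Ycls_small; lia.
have small a : a != a0 -> (f a : nat) != p -> ((f a : nat) != p.-1) ==> (Ycls p (f a) < p.-2).
  move=> /pos [f0]; rewrite Y_adj0 // => H fp; apply/implyP => fp1; move: H.
  rewrite (negbTE fp) (negbTE fp1) !orbF; have := Ycls_lt (f a) p0; lia.
move=> a b ab.
have [aE|aN] := eqVneq a a0.
  have ba : b != a0 by rewrite -aE eq_sym.
  rewrite aE fa0 eqxx; have [b0 _] := pos _ ba; have := small _ ba.
  rewrite eqn0Ngt b0 /=; case: eqVneq => [_ _|_ /(_ isT)]; first by lia.
  by case: eqVneq => [->|_] /=; rewrite ?Ep; lia.
have [a0' Ya] := pos _ aN; rewrite (eqn0Ngt (f a)) a0' /=.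
have Sa := small _ aN.
have [bE|bN] := eqVneq b a0.
  rewrite bE fa0 eqxx; move: Sa.
  case: eqVneq => [_ _|_ /(_ isT)]; first by lia.
  by case: eqVneq => [->|_] /=; rewrite ?Ep; lia.
have [b0' Yb] := pos _ bN; rewrite (eqn0Ngt (f b)) b0' /=.
have Sb := small _ bN; have := adj _ _ ab; rewrite Y_adj_pos //.
have Pp : Ycls p p = p.-1 by apply: Ycls_small.
move: Sa Sb.
case: (eqVneq (f a : nat) p) => [->|ap].
  case: (eqVneq (f b : nat) p) => [->|bp]; first by rewrite eqxx.
  move=> _ /(_ isT); case: (eqVneq (f b : nat) p.-1) => [->|bp1] /=; last by lia.
  by rewrite andbF.
move=> /(_ isT) Sa; have := Ycls_lt (f a) p0.
case: (eqVneq (f b : nat) p) => [->|bp].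
  move: Sa; case: (eqVneq (f a : nat) p.-1) => [->|ap1] /=; last by lia.
  by rewrite andbF.
by move=> -> _ /andP [->].
Qed.

(** The right-hand side is the ceiling of [(m - r) / p]. *)
Lemma count_mod_lt p r m : r < p -> \sum_(x < m) (x %% p == r : nat) <= (m + (p - 1 - r)) %/ p.
Proof.
move=> rp; have p0 : 0 < p by lia.
elim: m => [|m IH]; first by rewrite big_ord0.
rewrite big_ord_recr /= addSn divnS // addnC leq_add //.
case: eqP => // E; rewrite [X in X + _](divn_eq m p) E.
rewrite (_ : (m %/ p * p + r + (p - 1 - r)).+1 = (m %/ p).+1 * p) ?dvdn_mull //.
by rewrite mulSn; lia.
Qed.

Lemma Y_nonadj_count p y : 3 <= p ->
  \sum_(x < y) (~~ Y_adj p x y : nat) + (y == p.-1) <= y.+1 %/ p.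
Proof.
move=> p3; have p0 : 0 < p by lia.
have E0 k : 0 < k <= p -> Ycls p k = k.-1 by case/andP => *; apply: Ycls_small.
case: (ltngtP y p) => [yp|yp|->].
- rewrite big1 => [|x _].
    by case: eqP => // ->; rewrite add0n prednK // divnn p0.
  have xy := ltn_ord x; apply/eqP; rewrite eqb0 negbK.
  case: (posnP x) => [->|x0]; first by rewrite Y_adj0 ?E0; lia.
  by rewrite Y_adj_pos ?E0; lia.
- have -> : (y == p.-1) = false by lia.
  rewrite addn0 divnS // addnC.
  (* Non-neighbours among [x < y] are the [x] congruent to [y], where [0] counts exactly when [y] is
     in class [p - 1]. For [y] in class [p - 2] the vertex [0] comes in addition, paid for by the
     increment of the quotient when [p] divides [y + 1]. *)
  have cnt : \sum_(x < y) (x %% p == y %% p : nat) <= y %/ p.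
    have rp : y %% p < p by rewrite ltn_pmod.
    apply: leq_trans (count_mod_lt y rp) _.
    rewrite [X in X + _](divn_eq y p); move: (y %% p) (y %/ p) rp => r b rp.
    by rewrite -addnA divnMDl // divn_small ?addn0 //; lia.
  have y0 : 0 < y by lia.
  have sum0 : \sum_(x < y) (((x : nat) == 0) && (p %| y.+1) : nat) = (p %| y.+1).
    rewrite (bigD1 (Ordinal y0)) //= big1 ?addn0 // => x; rewrite -val_eqE /= => /negbTE ->.
    by [].
  apply: leq_trans (leq_add cnt (leqnn _)); rewrite -sum0 -big_split.
  apply: leq_sum => x _ /=.
  case: (posnP x) => [->|x0].
    have K1 : (Ycls p y == p.-1) = (p %| y).
      by rewrite Ycls_eq ?ltn_predL // prednK // modnn.
    have K2 : (Ycls p y == p.-2) = (p %| y.+1).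
      rewrite Ycls_eq //; last by lia.
      by rewrite -(eqn_modDr 1) !addn1 (_ : p.-2.+2 = p) ?modnn //; lia.
    rewrite Y_adj0 // K1 K2 mod0n [0 == _]eq_sym -/(dvdn p y).
    by case: (p %| y); case: (p %| y.+1) => //=; case: (~~ _).
  have F : [|| (x == p :> nat) && (y == p.-1) | (x == p.-1 :> nat) && (y == p)] = false by lia.
  have /eqP K : (Ycls p y).+1 == y %[mod p] by rewrite eq_sym -Ycls_eq ?Ycls_lt.
  by rewrite Y_adj_pos // F andbT negbK Ycls_eq ?Ycls_lt // K leq_addr.
- have -> : (p == p.-1) = false by lia.
  rewrite addn0 divnS // divnn p0 (leq_trans _ (leq_addl _ _)) //.
  have lp : p.-1 < p by lia.
  rewrite (bigD1 (Ordinal lp)) //= big1 => [|x]; first by rewrite addn0; case: (~~ _).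
  rewrite -val_eqE /= => xp; have xl := ltn_ord x; apply/eqP; rewrite eqb0 negbK.
  case: (posnP x) => [->|x0]; first by rewrite Y_adj0 ?eqxx ?orbT.
  by rewrite Y_adj_pos ?E0; lia.
Qed.

Lemma Yp_num_edges p n : 3 <= p -> p <= n -> eY p n <= num_edges (@Yp p n).
Proof.
move=> p3 pn; rewrite /num_edges card_sum_indicator.
rewrite -(pair_bigA _ (fun x y : 'I_n => ((x < y) && Yp p x y : nat))) /= exchange_big /=.
have E (y : 'I_n) : \sum_(x < n) ((x < y) && Yp p x y : nat) = \sum_(x < y) (Y_adj p x y : nat).
  rewrite (big_ord_widen n (fun x => Y_adj p x y : nat)) ?[y <= n]ltnW // [RHS]big_mkcond.
  by apply: eq_bigr => x _; case: (x < y).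
under eq_bigr => y _ do rewrite E.
have lp : p.-1 < n by lia.
(* Edges are counted at their larger end; the additional edge in [eY] is credited to
   [u_2 = p - 1]. *)
have -> : eY p n = \sum_(y < n) (y - y.+1 %/ p) + \sum_(y < n) ((y : nat) == p.-1).
  rewrite /eY -addn1; congr (_ + _).
  rewrite (bigD1 (Ordinal lp)) //= eqxx big1 // => x; rewrite -val_eqE /= => /negbTE ->.
  by [].
rewrite -big_split; apply: leq_sum => y _ /=.
have H := Y_nonadj_count y p3.
have T : \sum_(x < y) (Y_adj p x y : nat) + \sum_(x < y) (~~ Y_adj p x y : nat) = y.
  rewrite -big_split -[RHS]card_ord -sum1_card; apply: eq_bigr => x _ /=.
  by case: (Y_adj p x y).
move: H T; move: (\sum_(x < y) _) (\sum_(x < y) _) => s s' H T.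
move: H; case: (eqVneq (y : nat) p.-1) => [yp|_] /=; last by rewrite addn0; lia.
have -> : y.+1 %/ p = 1 by rewrite yp prednK ?divnn; lia.
lia.
Qed.

Theorem theorem1p3 (p q : nat) :
  3 <= p -> 1 <= q ->
  exists N : nat, forall n : nat, N <= n ->
    @in_calG n p 1 (@Yp p n) /\
    (forall G : rel 'I_n, @in_calG n p 1 G -> @in_calG n p q G).
Proof.
move=> p3 q0.
have K1q n (H : rel 'I_n) : book_free p 1 H -> book_free p q H.
  move=> nb [f [fi fh]]; apply: nb.
  exists (fun a => match a with inl i => f (inl i) | inr _ => f (inr (Ordinal q0)) end); split.
    by move=> [i|i] [j|j]; [move/fi=> [->]|move/fi|move/fi|rewrite !ord1].
  by move=> [i|i] [j|j] //= ij; apply: fh.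
pose M := 20 * p ^ 3 * (160 * p ^ 3 + q).
exists (M + M * M + 2 * p + 1) => n Mn.
(* By [K1q] the bound for [q] covers [q = 1] too, and [Yp] attains it in both problems, so the two
   maxima agree. *)
have upper (H : rel 'I_n) : simple_graph H -> non_p_partite p H -> book_free p q H ->
    num_edges H <= num_edges (@Yp p n).
  move=> Hs Hp Hb; apply: leq_trans (Yp_num_edges p3 _); last by lia.
  by apply: num_edges_upper Hs Hp Hb => //; rewrite -/M; lia.
have Ys := @Yp_simple p n; have Yf := @Yp_K_free p n p3.
have Yn : non_p_partite p (@Yp p n) by apply: Yp_not_p_partite => //; lia.
split; first by split => // H Hs Hp /K1q; exact: upper.
move=> G [Gs Gp Gf Gmax]; split => //; first exact: K1q.
by move=> H Hs Hp Hb; apply: leq_trans (upper H Hs Hp Hb) (Gmax _ Ys Yn Yf).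
Qed.
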